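(* Let $\|\cdot\|$ be a $p$-norm on $\mathbb{R}^{d(N+1)}$, let $U^*\in\mathbb{R}^{d(N+1)}$, and let $(U^k)_{k\in\mathbb{N}_0}$ be a sequence in $\mathbb{R}^{d(N+1)}$ such that, for some constants $\beta>0$ and $q\ge 1$, $$\|U^k-U^*\|\le \beta\,\|U^{k-1}-U^*\|^q\qquad\text{for all } k\ge 1 .$$ Let $K\ge 1$ be an integer and let $r>0$. (i) If $q>1$, then $$\|U^K-U^*\|\le \beta^{\frac{q^K-1}{q-1}}\,\|U^0-U^*\|^{q^K},$$ and consequently, if $\|U^0-U^*\|=R$ with $$R\le\left(\frac{r}{\beta^{\frac{q^K-1}{q-1}}}\right)^{1/q^K},$$ then $\|U^K-U^*\|\le r$. (ii) If $q=1$, the same holds with the exponent $\frac{q^K-1}{q-1}$ replaced by its limit $K$ as $q\to1$: if $\|U^0-U^*\|=R$ with $R\le r/\beta^K$, then $\|U^K-U^*\|\le r$.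
   Context: Here $d,N\ge1$ are integers. The sequence $(U^k)$ is thought of as the iterates of a time-parallel method with target $U^*$; $r$ is the prescribed tolerance (radius of the inner ball around $U^*$), $K$ is the iteration budget, and $R$ is the error of the initial guess $U^0$ (radius of the outer ball). *)

(* Defs.v *)
From HB Require Import structures.
From mathcomp Require Import all_boot all_order all_algebra.
From mathcomp Require Import all_classical all_reals all_analysis.

Set Implicit Arguments.
Unset Strict Implicit.
Unset Printing Implicit Defensive.

Import Order.TTheory GRing.Theory Num.Theory.
Import numFieldNormedType.Exports.

Local Open Scope classical_set_scope.
Local Open Scope ring_scope.

(* The exponent is extended so that p = +oo gives the maximum norm; this is a
   norm for 1 <= p, and the value at -oo is a placeholder. *)
Definition pnorm (R : realType) (n : nat) (p : \bar R) (x : 'cV[R]_n) : R :=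
  match p with
  | p%:E => (\sum_(i < n) `|x i 0| `^ p) `^ p^-1
  | +oo%E => \big[Num.max/0]_(i < n) `|x i 0|
  | -oo%E => 0
  end.

(* Main.v *)
Require Import Defs.
From HB Require Import structures.
From mathcomp Require Import all_boot all_order all_algebra.
From mathcomp Require Import all_classical all_reals all_analysis.

Set Implicit Arguments.
Unset Strict Implicit.
Unset Printing Implicit Defensive.

Import Order.TTheory GRing.Theory Num.Theory.
Import numFieldNormedType.Exports.

Local Open Scope classical_set_scope.
Local Open Scope ring_scope.

(** Unrolling the recursion e_k <= beta e_(k-1)^q down to e_0 multiplies the
    exponent of e_0 by q at each step and accumulates the factor beta to the
    power 1 + q + ... + q^(K-1) ([power_recursion_bound]).  This sum of powers,
    rather than the quotient (q^K - 1)/(q - 1), is the natural exponent: one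
    induction covers every q >= 0, the sum equals the quotient for q <> 1 and
    K for q = 1, and being a polynomial in q it also explains why the quotient
    tends to K ([geometric_quotient_cvg]).  The tolerance statements come from
    solving B rho^Q <= r for rho.  Nonnegativity of the p-norm is what makes
    the real powers of the errors monotone and multiplicative. *)

Lemma pnorm_ge0 (R : realType) (n : nat) (p : \bar R) (x : 'cV[R]_n) :
  0 <= pnorm p x.
Proof.
case: p => [p| |] //=; first exact: powR_ge0.
by elim/big_rec: _ => // i y _ y0; rewrite le_max y0 orbT.
Qed.

(** Induction on k: raising the bound for k to the power q and multiplying by
    b turns the exponent s of b into 1 + s q, which is Horner's recursion for
    the sum of powers of q. *)
Lemma power_recursion_bound (R : realType) (e : nat -> R) (b q : R) :
    (forall k, 0 <= e k) -> 0 < b -> 0 <= q ->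
    (forall k, e k.+1 <= b * e k `^ q) ->
  forall k, e k <= b `^ (\sum_(i < k) q ^+ i) * e 0%N `^ (q ^+ k).
Proof.
move=> e0 b0 q0 he; elim=> [|k IH].
  by rewrite big_ord0 powRr0 expr0 powRr1 // mul1r.
apply: (le_trans (he k)).
have hs : \sum_(i < k.+1) q ^+ i = 1 + (\sum_(i < k) q ^+ i) * q.
  rewrite big_ord_recl expr0 mulr_suml; congr (_ + _).
  by apply: eq_bigr => i _; rewrite -exprSr.
rewrite hs powRD ?(gt_eqF b0) ?implybT // powRr1 ?(ltW b0) // -mulrA.
rewrite ler_pM2l // exprSr !powRrM -powRM ?powR_ge0 //.
by apply: ge0_ler_powR; rewrite ?nnegrE ?mulr_ge0 ?powR_ge0.
Qed.

Lemma geometric_sumE (F : fieldType) (q : F) (K : nat) : q != 1 ->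
  \sum_(i < K) q ^+ i = (q ^+ K - 1) / (q - 1).
Proof. by move=> q1; rewrite subrX1 mulrC mulKf // subr_eq0. Qed.

(** Away from 1 the quotient is the polynomial 1 + t + ... + t^(K-1), whose
    value at 1 is K. *)
Lemma geometric_quotient_cvg (R : realType) (K : nat) :
  (t ^+ K - 1) / (t - 1) @[t --> (1 : R)^'] --> (K%:R : R).
Proof.
have hc : \sum_(i < K) t ^+ i @[t --> (1 : R)^'] --> (K%:R : R).
  have -> : (K%:R : R) = \sum_(i < K) 1 ^+ i.
    by under eq_bigr do rewrite expr1n; rewrite sumr_const card_ord.
  apply: cvg_big => [|i _]; first exact: add_continuous.
  apply: cvg_within_filter.
  exact: exprn_continuous.
apply: cvg_trans hc; apply: near_eq_cvg.
near=> t; apply: geometric_sumE.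
by near: t; exact: nbhs_dnbhs_neq.
Unshelve. all: by end_near. Qed.

(** The threshold on x is the solution of B x^Q = r. *)
Lemma powR_ball_bound (R : realType) (B Q r x : R) :
    0 < B -> 0 < Q -> 0 <= r -> 0 <= x ->
  x <= (r / B) `^ (1 / Q) -> B * x `^ Q <= r.
Proof.
move=> B0 Q0 r0 x0 hx.
have rB0 : 0 <= r / B by rewrite divr_ge0 // ltW.
rewrite mulrC -ler_pdivlMr //.
have -> : r / B = ((r / B) `^ (1 / Q)) `^ Q.
  by rewrite -powRrM div1r mulVf ?powRr1 // gt_eqF.
by apply: ge0_ler_powR; rewrite ?nnegrE ?powR_ge0 // ltW.
Qed.

Theorem mainTheorem1 (R : realType) (d N : nat) (hd : (1 <= d)%N) (hN : (1 <= N)%N)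
    (p : \bar R) (hp : (1%:E <= p)%E)
    (Ustar : 'cV[R]_(d * N.+1)) (U : nat -> 'cV[R]_(d * N.+1))
    (beta q : R) (hbeta : 0 < beta) (hq : 1 <= q)
    (hU : forall k : nat, (1 <= k)%N ->
      pnorm p (U k - Ustar) <= beta * pnorm p (U k.-1 - Ustar) `^ q)
    (K : nat) (hK : (1 <= K)%N) (r : R) (hr : 0 < r) :
  (1 < q ->
    pnorm p (U K - Ustar) <=
      beta `^ ((q ^+ K - 1) / (q - 1)) * pnorm p (U 0%N - Ustar) `^ (q ^+ K) /\
    (forall rho : R, pnorm p (U 0%N - Ustar) = rho ->
      rho <= (r / beta `^ ((q ^+ K - 1) / (q - 1))) `^ (1 / q ^+ K) ->
      pnorm p (U K - Ustar) <= r)) /\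
  ((t ^+ K - 1) / (t - 1) @[t --> (1 : R)^'] --> (K%:R : R)) /\
  (q = 1 ->
    pnorm p (U K - Ustar) <= beta ^+ K * pnorm p (U 0%N - Ustar) /\
    (forall rho : R, pnorm p (U 0%N - Ustar) = rho ->
      rho <= r / beta ^+ K ->
      pnorm p (U K - Ustar) <= r)).
Proof.
have bound : pnorm p (U K - Ustar) <=
    beta `^ (\sum_(i < K) q ^+ i) * pnorm p (U 0%N - Ustar) `^ (q ^+ K).
  apply: (power_recursion_bound (e := fun k => pnorm p (U k - Ustar))) => //.
  - by move=> k; exact: pnorm_ge0.
  - exact: le_trans hq.
  - by move=> k; exact: hU.
split; [|split].
- move=> q1; rewrite geometric_sumE ?gt_eqF // in bound.
  split=> // rho <- hrho; apply: (le_trans bound).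
  apply: powR_ball_bound hrho; rewrite ?powR_gt0 ?pnorm_ge0 ?ltW //.
  by rewrite exprn_gt0 // (lt_trans ltr01).
- exact: geometric_quotient_cvg.
- move=> q1; move: bound; rewrite q1.
  under eq_bigr do rewrite expr1n.
  rewrite sumr_const card_ord powR_mulrn ?(ltW hbeta) // expr1n.
  rewrite powRr1 ?pnorm_ge0 // => bound.
  split=> // rho <- hrho; apply: (le_trans bound).
  by rewrite mulrC -ler_pdivlMr // exprn_gt0.
Qed.
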